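(* Let $a,b\in\mathbb{N}$ with $a>b$, let $\alpha_1,\dots,\alpha_{a+1},\beta_1,\dots,\beta_{b+1}\in\mathbb{R}$ with $\alpha_1\beta_1\neq 0$, let $\alpha\in\mathbb{R}\setminus\{0\}$, $K\in\mathbb{R}$ and $\tau>0$. Consider the strictly causal linear control system $$\alpha_{1}y^{(a)}+\alpha_2y^{(a-1)}+\cdots+\alpha_{a+1}y=\beta_{1}u^{(b)}+\beta_2u^{(b-1)}+\cdots+\beta_{b+1}u$$ in closed loop with the intelligent proportional controller $$u(t)=\frac{1}{\alpha}\left(-Ky(t)-\hat F(t)\right),\qquad \hat F(t)=\dot y(t)-\alpha u_\tau(t).$$ Then the closed-loop system can be expressed as the neutral delay system of the same order $a$ $$\alpha_{1}\left(y^{(a)}-y_{\tau}^{(a)}\right)+\alpha_2\left(y^{(a-1)}-y_\tau^{(a-1)}\right)+\cdots+\alpha_{a+1}\left(y-y_{\tau}\right)=v$$ subject to the PD controller of order $(b+1)$ $$v=K_{d1}y^{(b+1)}+K_{d2}y^{(b)}+\cdots+K_{d(b+2)}y,$$ whose gains satisfy $$K_{d1}=-\frac{1}{\alpha}\beta_1,\qquad K_{d(b+2)}=-\frac1\alpha\beta_{b+1}K,\qquad K_{dj}=-\frac1\alpha\left(\beta_{j-1}K+\beta_j\right)\quad\text{for all } j\in\{2,\dots,b+1\}.$$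
   Context: Here $\mathbb{N}=\{0,1,2,\dots\}$; $y(t)\in\mathbb{R}$ is the measured output, $u(t)\in\mathbb{R}$ the control input. For a function $f$ of time and a delay $\tau>0$, $f_\tau(t):=f(t-\tau)$. $f^{(k)}$ denotes the $k$-th time derivative of $f$ and $f^{(k)}_\tau$ denotes $t\mapsto f^{(k)}(t-\tau)$. ''Strictly causal'' means $a>b$. The parameters $\alpha\neq 0$ and $K$ are the design parameter and control gain of the controller; $\hat F$ is an estimate of $F(t):=\dot y(t)-\alpha u(t)$. *)

(* Defs.v *)
From Stdlib Require Import Reals.
From Coquelicot Require Import Coquelicot.
Open Scope R_scope.

Definition delay (tau : R) (f : R -> R) : R -> R := fun t => f (t - tau).

(* Coquelicot's [Derive_n] is total and [ex_derive_n f n t] alone says nothing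
   about the lower-order derivatives, so all orders up to n are required. *)
Definition differentiable_after (t0 : R) (n : nat) (f : R -> R) : Prop :=
  forall (k : nat) (t : R), (k <= n)%nat -> t0 < t -> ex_derive_n f k t.

(* c_1 f^(n) + c_2 f^(n-1) + ... + c_(n+1) f at time t; coefficients are indexed
   from 1 and the values of c outside {1, ..., n+1} are irrelevant. *)
Definition lin_diff_op (n : nat) (c : nat -> R) (f : R -> R) (t : R) : R :=
  sum_n_m (fun i : nat => c i * Derive_n f (n + 1 - i) t) 1 (n + 1).

Definition plant (a b : nat) (al be : nat -> R) (y u : R -> R) (t : R) : Prop :=
  lin_diff_op a al y t = lin_diff_op b be u t.

Definition F_hat (alpha tau : R) (y u : R -> R) (t : R) : R :=
  Derive y t - alpha * delay tau u t.

Definition iP_controller (alpha K tau : R) (y u : R -> R) (t : R) : Prop :=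
  u t = 1 / alpha * (- K * y t - F_hat alpha tau y u t).

Definition neutral_system (a : nat) (al : nat -> R) (tau : R)
    (y v : R -> R) (t : R) : Prop :=
  sum_n_m (fun i : nat =>
      al i * (Derive_n y (a + 1 - i) t - delay tau (Derive_n y (a + 1 - i)) t))
    1 (a + 1) = v t.

Definition PD_controller (n : nat) (Kd : nat -> R) (y v : R -> R) (t : R) : Prop :=
  v t = lin_diff_op n Kd y t.

(* Main.v *)
Require Import Defs.
From Stdlib Require Import Reals Lra Lia Arith.
From Coquelicot Require Import Coquelicot.
Open Scope R_scope.

(** Write [A] and [B] for the differential operators on the two sides of the
    plant. The estimate of [F] uses the delayed input, so the control law says
    [u - u_tau = - (1/alpha) (y' + K y)] on the half-line [t > t0]. Being an
    identity on an open set, it may be differentiated up to order [b]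
    ([iP_controller_increment]), and applying [B] gives
    [B u - B u_tau = - (1/alpha) B (y' + K y)]. The right-hand side is a
    differential operator of order [b + 1] in [y], whose coefficients are those
    of the product of [B] with the first-order operator
    [- (1/alpha) (d/dt + K)]; these are the PD gains
    ([lin_diff_op_first_order_factor]). On the other side, the neutral
    expression is [A y - A y_tau].

    Hence, with [v] equal to the PD law, the neutral equation at [t] reads
    [A y - B u = A y_tau - B u_tau]: the residual of the plant has the same value
    at [t] and at [t - tau]. If the plant holds at all times, both residuals
    vanish. Conversely the residual is [tau]-periodic and vanishes on the initial
    window, so it vanishes everywhere ([method_of_steps]). *)

(** The terms of [sum_n_m] live in the carrier of [R_AbelianMonoid], which [ring]
   does not recognise as [R]. *)
Ltac ring_in_R :=
  unfold plus; simpl;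
  match goal with |- @eq _ ?x ?y => change (@eq R x y) end; ring.

Lemma sum_n_m_Rminus (f g : nat -> R) (m n : nat) :
  sum_n_m (fun i => f i - g i) m n = sum_n_m f m n - sum_n_m g m n.
Proof.
  assert (H := sum_n_m_plus (fun i => f i - g i) g m n).
  rewrite (sum_n_m_ext _ f) in H by (intros i; ring_in_R).
  rewrite H; symmetry; ring_in_R.
Qed.

(** Coefficients of [(c_1 D^n + ... + c_(n+1)) (p D + q)]. The sequence [c] has to
    be cut off to the range [1, n + 1], since its values elsewhere are arbitrary
    and the product has one coefficient more. *)
Definition first_order_mul (n : nat) (c : nat -> R) (p q : R) (j : nat) : R :=
  p * (if (j <=? n + 1)%nat then c j else 0)
  + q * (if (2 <=? j)%nat then c (j - 1)%nat else 0).

(** The part in [p] keeps its indices and gets a null last term; the part in [q]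
    is shifted by one and gets a null first term. *)
Lemma lin_diff_op_first_order_factor (n : nat) (c : nat -> R) (p q : R)
    (f : R -> R) (t : R) :
  lin_diff_op (n + 1) (first_order_mul n c p q) f t =
  sum_n_m (fun i => c i * (p * Derive_n f (S (n + 1 - i)) t
                           + q * Derive_n f (n + 1 - i) t)) 1 (n + 1).
Proof.
  unfold lin_diff_op, first_order_mul.
  rewrite (sum_n_m_ext _ (fun i => plus
    (p * (if (i <=? n + 1)%nat then c i else 0) * Derive_n f (n + 1 + 1 - i) t)
    (q * (if (2 <=? i)%nat then c (i - 1)%nat else 0)
       * Derive_n f (n + 1 + 1 - i) t)))
    by (intros i; ring_in_R).
  rewrite sum_n_m_plus.
  replace (n + 1 + 1)%nat with (S (n + 1)) by lia.
  rewrite sum_n_Sm by lia.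
  rewrite (sum_Sn_m (fun i => q * _ * _)) by lia.
  rewrite <- (sum_n_m_S (fun i => q * _ * _)).
  replace (S (n + 1) <=? n + 1)%nat with false
    by (symmetry; apply Nat.leb_gt; lia).
  replace (2 <=? 1)%nat with false by reflexivity.
  rewrite !Rmult_0_r, !Rmult_0_l.
  change (@plus R_AbelianMonoid) with Rplus.
  rewrite Rplus_0_l, Rplus_0_r.
  change Rplus with (@plus R_AbelianMonoid).
  rewrite <- sum_n_m_plus.
  apply sum_n_m_ext_loc; intros i Hi.
  replace (i <=? n + 1)%nat with true by (symmetry; apply Nat.leb_le; lia).
  replace (2 <=? S i)%nat with true by (symmetry; apply Nat.leb_le; lia).
  replace (S i - 1)%nat with i by lia.
  replace (S (n + 1) - i)%nat with (S (n + 1 - i)) by lia.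
  replace (S (n + 1) - S i)%nat with (n + 1 - i)%nat by lia.
  ring_in_R.
Qed.

Lemma differentiable_after_locally (t0 : R) (n : nat) (f : R -> R) (t : R) :
  differentiable_after t0 n f -> t0 < t ->
  locally t (fun s => forall k, (k <= n)%nat -> ex_derive_n f k s).
Proof.
  intros Hf Ht; generalize (open_gt t0 t Ht).
  apply filter_imp; intros s Hs k Hk; exact (Hf k s Hk Hs).
Qed.

Lemma differentiable_after_le (t0 t1 : R) (m n : nat) (f : R -> R) :
  t0 <= t1 -> (m <= n)%nat ->
  differentiable_after t0 n f -> differentiable_after t1 m f.
Proof. intros Ht Hn Hf k t Hk Hkt; apply Hf; [lia | lra]. Qed.

Lemma differentiable_after_plus (t0 : R) (n : nat) (f g : R -> R) :
  differentiable_after t0 n f -> differentiable_after t0 n g ->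
  differentiable_after t0 n (fun t => f t + g t).
Proof.
  intros Hf Hg k t Hk Ht.
  apply ex_derive_n_plus; apply (differentiable_after_locally t0); trivial;
    now apply (differentiable_after_le t0 t0 k n); [right | |].
Qed.

Lemma differentiable_after_scal (t0 : R) (n : nat) (c : R) (f : R -> R) :
  differentiable_after t0 n f -> differentiable_after t0 n (fun t => c * f t).
Proof. intros Hf k t Hk Ht; apply ex_derive_n_scal_l; now apply Hf. Qed.

Lemma differentiable_after_delay (t0 tau : R) (n : nat) (f : R -> R) :
  differentiable_after (t0 - tau) n f ->
  differentiable_after t0 n (delay tau f).
Proof.
  intros Hf k t Hk Ht.
  apply (ex_derive_n_comp_trans f k t (- tau)); apply Hf; [exact Hk | lra].
Qed.

Lemma differentiable_after_Derive (t0 : R) (n : nat) (f : R -> R) :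
  differentiable_after t0 (S n) f -> differentiable_after t0 n (Derive f).
Proof.
  intros Hf [|k] t Hk Ht; [exact I |].
  apply (ex_derive_ext (Derive_n f (S k))).
  - intros s; symmetry.
    change (Derive f) with (Derive_n f 1).
    now rewrite Derive_n_comp, Nat.add_1_r.
  - apply (Hf (S (S k)) t); [lia | exact Ht].
Qed.

Lemma Derive_n_delay (tau : R) (f : R -> R) (k : nat) (t : R) :
  Derive_n (delay tau f) k t = Derive_n f k (t - tau).
Proof. exact (Derive_n_comp_trans f k t (- tau)). Qed.

(** The control law determines [u - u_tau] on an open half-line, so it passes to
    derivatives. The derivative of order [k] of [u] costs one more order of [y],
    since [y'] enters the estimate of [F]. *)
Lemma iP_controller_increment (n : nat) (alpha K tau t0 : R) (y u : R -> R) :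
  alpha <> 0 ->
  differentiable_after t0 (S n) y ->
  differentiable_after (t0 - tau) n u ->
  (forall t, t0 < t -> iP_controller alpha K tau y u t) ->
  forall (k : nat) (t : R), (k <= n)%nat -> t0 < t ->
  Derive_n u k t - Derive_n u k (t - tau) =
  - (1 / alpha) * Derive_n y (S k) t + - (1 / alpha) * K * Derive_n y k t.
Proof.
  intros Halpha Hy Hu Hc k t Hk Ht.
  assert (Hy0 : differentiable_after t0 k y)
    by (apply (differentiable_after_le t0 t0 k (S n)); [lra | lia | exact Hy]).
  assert (Hy1 : differentiable_after t0 k (Derive y)).
  { apply differentiable_after_Derive.
    apply (differentiable_after_le t0 t0 (S k) (S n)); [lra | lia | exact Hy]. }
  assert (Hu0 : differentiable_after t0 k (delay tau u)).
  { apply differentiable_after_delay.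
    apply (differentiable_after_le (t0 - tau) (t0 - tau) k n);
      [lra | lia | exact Hu]. }
  rewrite (Derive_n_ext_loc u (fun s => delay tau u s +
    (- (1 / alpha) * Derive y s + - (1 / alpha) * K * y s))).
  2:{ generalize (open_gt t0 t Ht); apply filter_imp; intros s Hs.
      rewrite (Hc s Hs); unfold F_hat; field; exact Halpha. }
  rewrite Derive_n_plus.
  2, 3: apply (differentiable_after_locally t0); trivial.
  2: apply differentiable_after_plus; apply differentiable_after_scal; trivial.
  rewrite Derive_n_plus.
  2, 3: apply (differentiable_after_locally t0);
    [apply differentiable_after_scal |]; trivial.
  rewrite !Derive_n_scal_l, Derive_n_delay.
  change (Derive y) with (Derive_n y 1).
  rewrite Derive_n_comp, Nat.add_1_r; ring.
Qed.

Lemma lin_diff_op_increment_iP (n : nat) (c : nat -> R) (alpha K tau t0 : R)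
    (y u : R -> R) (t : R) :
  alpha <> 0 ->
  differentiable_after t0 (S n) y ->
  differentiable_after (t0 - tau) n u ->
  (forall s, t0 < s -> iP_controller alpha K tau y u s) ->
  t0 < t ->
  lin_diff_op n c u t - lin_diff_op n c u (t - tau) =
  lin_diff_op (n + 1)
    (first_order_mul n c (- (1 / alpha)) (- (1 / alpha) * K)) y t.
Proof.
  intros Halpha Hy Hu Hc Ht.
  rewrite lin_diff_op_first_order_factor; unfold lin_diff_op.
  rewrite <- sum_n_m_Rminus.
  apply sum_n_m_ext_loc; intros i Hi.
  rewrite <- Rmult_minus_distr_l.
  now rewrite (iP_controller_increment n alpha K tau t0 y u) by (trivial; lia).
Qed.

Lemma neutral_system_iff_increment (a : nat) (al : nat -> R) (tau : R)
    (y v : R -> R) (t : R) :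
  neutral_system a al tau y v t <->
  lin_diff_op a al y t - lin_diff_op a al y (t - tau) = v t.
Proof.
  unfold neutral_system, lin_diff_op; rewrite <- sum_n_m_Rminus.
  rewrite (sum_n_m_ext _ (fun i => al i * Derive_n y (a + 1 - i) t
    - al i * Derive_n y (a + 1 - i) (t - tau)))
    by (intros i; unfold delay; ring_in_R).
  reflexivity.
Qed.

(** Every [t > t0] is carried into the initial window by finitely many backward
    steps of length [tau], by the Archimedean property. *)
Lemma method_of_steps (P : R -> Prop) (t0 tau : R) :
  0 < tau ->
  (forall t, t0 - tau < t <= t0 -> P t) ->
  (forall t, t0 < t -> P (t - tau) -> P t) ->
  forall t, t0 < t -> P t.
Proof.
  intros Htau Hinit Hstep.
  assert (H : forall (n : nat) (t : R),
    t0 - tau < t -> t <= t0 + INR n * tau -> P t).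
  { induction n as [|n IH]; intros t Hlow Hup.
    - apply Hinit; simpl in Hup; lra.
    - destruct (Rle_or_lt t t0) as [Hle | Hlt]; [apply Hinit; lra |].
      apply Hstep; [exact Hlt |].
      rewrite S_INR in Hup; apply IH; lra. }
  intros t Ht.
  destruct (INR_unbounded ((t - t0) / tau)) as [n Hn].
  apply (H n); [lra |].
  apply (Rmult_lt_compat_r tau) in Hn; [| exact Htau].
  replace ((t - t0) / tau * tau) with (t - t0) in Hn by (field; lra).
  lra.
Qed.

Theorem lemma3 (a b : nat) (hab : (b < a)%nat)
    (al be : nat -> R) (hlead : al 1%nat * be 1%nat <> 0)
    (alpha K tau : R) (halpha : alpha <> 0) (htau : 0 < tau) :
  exists Kd : nat -> R,
    Kd 1%nat = - (1 / alpha) * be 1%nat /\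
    Kd (b + 2)%nat = - (1 / alpha) * be (b + 1)%nat * K /\
    (forall j : nat, (2 <= j <= b + 1)%nat ->
       Kd j = - (1 / alpha) * (be (j - 1)%nat * K + be j)) /\
    Kd 1%nat <> 0 /\
    forall (t0 : R) (y u : R -> R),
      differentiable_after (t0 - tau) a y ->
      differentiable_after (t0 - tau) b u ->
      (forall t : R, t0 - tau < t <= t0 -> plant a b al be y u t) ->
      (forall t : R, t0 < t -> iP_controller alpha K tau y u t) ->
      ((forall t : R, t0 < t -> plant a b al be y u t) <->
       exists v : R -> R,
         (forall t : R, t0 < t -> neutral_system a al tau y v t) /\
         (forall t : R, t0 < t -> PD_controller (b + 1) Kd y v t)).
Proof.
  assert (Hfirst : first_order_mul b be (- (1 / alpha)) (- (1 / alpha) * K) 1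
                   = - (1 / alpha) * be 1%nat).
  { unfold first_order_mul.
    replace (1 <=? b + 1)%nat with true by (symmetry; apply Nat.leb_le; lia).
    simpl; ring. }
  exists (first_order_mul b be (- (1 / alpha)) (- (1 / alpha) * K)).
  split; [exact Hfirst |].
  split.
  { unfold first_order_mul.
    replace (b + 2 <=? b + 1)%nat with false
      by (symmetry; apply Nat.leb_gt; lia).
    replace (2 <=? b + 2)%nat with true by (symmetry; apply Nat.leb_le; lia).
    replace (b + 2 - 1)%nat with (b + 1)%nat by lia; ring. }
  split.
  { intros j Hj; unfold first_order_mul.
    replace (j <=? b + 1)%nat with true by (symmetry; apply Nat.leb_le; lia).
    replace (2 <=? j)%nat with true by (symmetry; apply Nat.leb_le; lia).
    ring. }
  split.
  { rewrite Hfirst; apply Rmult_integral_contrapositive_currified.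
    - apply Ropp_neq_0_compat; unfold Rdiv; rewrite Rmult_1_l.
      now apply Rinv_neq_0_compat.
    - intros H; apply hlead; rewrite H; ring. }
  intros t0 y u Hy Hu Hinit Hc.
  assert (Hy' : differentiable_after t0 (S b) y)
    by (apply (differentiable_after_le (t0 - tau) t0 (S b) a); [lra | lia | trivial]).
  assert (HB := fun t => lin_diff_op_increment_iP b be alpha K tau t0 y u t
                           halpha Hy' Hu Hc).
  split.
  - intros Hplant.
    exists (lin_diff_op (b + 1)
              (first_order_mul b be (- (1 / alpha)) (- (1 / alpha) * K)) y).
    split; intros t Ht; [| reflexivity].
    apply neutral_system_iff_increment.
    rewrite <- (HB t Ht).
    (* The delayed time may still lie in the initial window. *)
    assert (Hdelayed : plant a b al be y u (t - tau)).
    { destruct (Rle_or_lt (t - tau) t0); [apply Hinit | apply Hplant]; lra. }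
    specialize (Hplant t Ht); unfold plant in Hplant, Hdelayed; lra.
  - intros [v [Hneutral HPD]].
    apply (method_of_steps _ t0 tau htau Hinit).
    intros t Ht Hdelayed.
    specialize (Hneutral t Ht); apply neutral_system_iff_increment in Hneutral.
    rewrite (HPD t Ht), <- (HB t Ht) in Hneutral.
    unfold plant in *; lra.
Qed.
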